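(* Let $(A,\triangleright,\triangleleft)$ be a braided group, $\mathcal P$ a group with center $Z(\mathcal P)$, and $\psi:A\times A\to Z(\mathcal P)$ a map with $\psi(a,bc)=\psi(a,b)\psi(a\triangleleft b,c)$ and $\psi(ab,c)=\psi(a,b\triangleright c)\psi(b,c)$ for all $a,b,c\in A$. Let $D$ be the group with underlying set $A\times\mathcal P\times A$ and multiplication $(a,P,c)(x,Q,z)=(a(c\triangleright x),P\psi(c,x)Q,(c\triangleleft x)z)$, let $V=A\times\{1\}\times\{1\}$, $H=\{1\}\times\{1\}\times A$, $\gamma_P=(1,P,1)$ for $P\in\mathcal P$, and $\phi:H\to V$, $\phi(1,1,a)=(a,1,1)$. Let $(\mathcal V,\rightharpoonup,\leftharpoonup)$ be the braided groupoid over $\mathcal P$ associated with $(D,V,H,\gamma,\phi)$ and $c(\alpha,\beta)=(\alpha\rightharpoonup\beta,\alpha\leftharpoonup\beta)$ its braiding, defined on composable pairs of arrows of $\mathcal V$. If $\alpha=\tau_P^{-1}(a,1,1)\tau_Q$ and $\beta=\tau_Q^{-1}(b,1,1)\tau_R$ with $a,b\in A$ and $P,Q,R\in\mathcal P$, then $$c(\alpha,\beta)=\bigl(\tau_P^{-1}(a\triangleright b,1,1)\tau_S,\;\tau_S^{-1}(a\triangleleft b,1,1)\tau_R\bigr),\qquad S=\psi(a,b)PQ^{-1}R.$$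
   Context: Groupoids: $\mathfrak s,\mathfrak e$ denote source and target; $g,h$ are composable if $\mathfrak e(g)=\mathfrak s(h)$, and the composite is written $gh$. $\mathcal G(P,Q)$ is the set of arrows with source $P$ and target $Q$, and $\mathcal G(P)=\mathcal G(P,P)$. A braided group is $(A,\triangleright,\triangleleft)$ with $A$ a group, $\triangleright$ a left action and $\triangleleft$ a right action of $A$ on the set $A$ satisfying $x\triangleright gh=(x\triangleright g)((x\triangleleft g)\triangleright h)$, $xy\triangleleft g=(x\triangleleft(y\triangleright g))(y\triangleleft g)$ and $xg=(x\triangleright g)(x\triangleleft g)$ for all $x,y,g,h\in A$. Groupoid associated with $(D,V,H,\gamma,\phi)$: let $O=1\in\mathcal P$ (so $\gamma_O=1$). Every element of $D$ is uniquely $g\gamma_Px$ with $g\in V$, $P\in\mathcal P$, $x\in H$, and $V\cap zHz^{-1}=\{1\}$ for all $z\in D$. Let $\mathcal D\rightrightarrows\mathcal P$ be a connected groupoid with $\mathcal D(O)=D$ and choose $\tau_P\in\mathcal D(O,P)$ for each $P$, $\tau_O=1$. Define subgroupoids with object set $\mathcal P$ by $\mathcal V(P,Q)=\tau_P^{-1}V\tau_Q$ and $\mathcal H(P,Q)=\tau_P^{-1}\gamma_PH\gamma_Q^{-1}\tau_Q$. Every arrow of $\mathcal D$ is uniquely a product of an arrow of $\mathcal V$ followed by an arrow of $\mathcal H$; for composable $x\in\mathcal H$, $g\in\mathcal V$ write $xg=(x\rightharpoonup g)(x\leftharpoonup g)$ with $x\rightharpoonup g\in\mathcal V$, $x\leftharpoonup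 g\in\mathcal H$. Let $\phi:\mathcal H\to\mathcal V$ be the groupoid isomorphism $\phi(\tau_P^{-1}\gamma_Px\gamma_Q^{-1}\tau_Q)=\tau_P^{-1}\phi(x)\tau_Q$, and for composable $g,h\in\mathcal V$ put $g\rightharpoonup h:=\phi^{-1}(g)\rightharpoonup h$ and $g\leftharpoonup h:=\phi(\phi^{-1}(g)\leftharpoonup h)$. These are the operations $\rightharpoonup,\leftharpoonup$ on $\mathcal V$ used in the definition of $c$. *)

(* Defs.v *)
From HB Require Import structures.
From mathcomp Require Import all_boot.
From mathcomp Require Import boolp classical_sets functions.

Set Implicit Arguments.
Unset Strict Implicit.
Unset Printing Implicit Defensive.

Import Algebra.

Local Open Scope classical_set_scope.
Local Open Scope group_scope.

Reserved Notation "a ▷ b" (at level 35, right associativity).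
Reserved Notation "a ◁ b" (at level 35, no associativity).
Reserved Notation "f · g" (at level 40, left associativity).
Reserved Notation "f ⇀ g" (at level 41, no associativity).
Reserved Notation "f ↼ g" (at level 41, no associativity).

HB.mixin Record isBraided A of Group A := {
  lact : A -> A -> A;
  ract : A -> A -> A;
  lact1 : forall x, lact 1 x = x;
  lactM : forall x y z, lact (x * y) z = lact x (lact y z);
  ract1 : forall x, ract x 1 = x;
  ractM : forall x y z, ract x (y * z) = ract (ract x y) z;
  lact_mul : forall x g h, lact x (g * h) = lact x g * lact (ract x g) h;
  ract_mul : forall x y g, ract (x * y) g = ract x (lact y g) * ract y g;
  braided_mul : forall x g, x * g = lact x g * ract x g
}.

#[short(type="braidedGroupType")]
HB.structure Definition BraidedGroup := {A of isBraided A & Group A}.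

Notation "a ▷ b" := (lact a b) : group_scope.
Notation "a ◁ b" := (ract a b) : group_scope.

Definition center (G : groupType) : set G :=
  [set z | forall x : G, commute z x].

Definition subgroup_set (G : groupType) (S : set G) : Prop :=
  [/\ S 1, forall x y, S x -> S y -> S (x * y) & forall x, S x -> S x^-1].

(* Composition is written in diagrammatic order: [f · g] is [f] followed
   by [g]. *)
Record groupoid (Ob : Type) := Groupoid {
  arr :> Ob -> Ob -> Type;
  gid : forall P, arr P P;
  gcomp : forall P Q R, arr P Q -> arr Q R -> arr P R;
  ginv : forall P Q, arr P Q -> arr Q P;
  gcompA : forall P Q R S (f : arr P Q) (g : arr Q R) (h : arr R S),
    gcomp f (gcomp g h) = gcomp (gcomp f g) h;
  gcomp1f : forall P Q (f : arr P Q), gcomp (gid P) f = f;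
  gcompf1 : forall P Q (f : arr P Q), gcomp f (gid Q) = f;
  gcompVf : forall P Q (f : arr P Q), gcomp (ginv f) f = gid Q;
  gcompfV : forall P Q (f : arr P Q), gcomp f (ginv f) = gid P
}.

Notation "f · g" := (gcomp f g) : group_scope.

Definition connected_groupoid (Ob : Type) (G : groupoid Ob) : Prop :=
  forall P Q, inhabited (G P Q).

(* The equality of the vertex group at [O] with [D] is rendered by an
   isomorphism [iota], given together with its inverse [iotaV]. *)
Record vertex_frame (D : groupType) (Ob : Type) (O : Ob) (G : groupoid Ob) :=
  VertexFrame {
  iota : D -> G O O;
  iotaV : G O O -> D;
  iotaK : cancel iota iotaV;
  iotaVK : cancel iotaV iota;
  iotaM : forall x y, iota (x * y) = iota x · iota y;
  tau : forall P, G O P;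
  tau_O : tau O = gid G O
}.

Record datum (D : groupType) (Ob : Type) (O : Ob) := Datum {
  dV : set D;
  dH : set D;
  dgam : Ob -> D;
  dphi : D -> D;
  dV_subgroup : subgroup_set dV;
  dH_subgroup : subgroup_set dH;
  dgam_O : dgam O = 1;
  dfactor : forall d : D, exists! t : D * Ob * D,
    [/\ dV t.1.1, dH t.2 & d = t.1.1 * dgam t.1.2 * t.2];
  dVH_conj : forall z, dV `&` [set z * x * z^-1 | x in dH] = [set 1];
  dphi_bij : set_bij dH dV dphi;
  dphiM : forall x y, dH x -> dH y -> dphi (x * y) = dphi x * dphi y
}.

Section AssociatedGroupoid.
Variables (D : groupType) (Ob : Type) (O : Ob) (X : datum D O).
Variables (G : groupoid Ob) (F : vertex_frame D O G).

Local Notation V := (dV X).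
Local Notation H := (dH X).
Local Notation gam := (dgam X).

Definition dphiV : D -> D := 'pinv_(fun=> 1) H (dphi X).

Lemma dphiV_H g : V g -> H (dphiV g).
Proof. by have [+ _ _] := bijpinv_bij (fun=> 1) (dphi_bij X); apply. Qed.

Lemma dphiK x : H x -> dphiV (dphi X x) = x.
Proof.
by move=> Hx; apply: pinvKV (mem_set Hx); case: (dphi_bij X).
Qed.

Lemma dphiVK g : V g -> dphi X (dphiV g) = g.
Proof.
by move=> Vg; case: (dphi_bij X) => _ _ sj; apply: (surjpK _ sj (mem_set Vg)).
Qed.

Definition conjtau (P Q : Ob) (d : D) : G P Q :=
  ginv (tau F P) · iota F d · tau F Q.

Definition conjtauV (P Q : Ob) (f : G P Q) : D :=
  iotaV F (tau F P · f · ginv (tau F Q)).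

Lemma conjtauK P Q : cancel (@conjtau P Q) (@conjtauV P Q).
Proof.
move=> d; rewrite /conjtauV /conjtau !gcompA gcompfV gcomp1f.
by rewrite -gcompA gcompfV gcompf1 iotaK.
Qed.

Lemma conjtauVK P Q : cancel (@conjtauV P Q) (@conjtau P Q).
Proof.
move=> f; rewrite /conjtauV /conjtau iotaVK !gcompA gcompVf gcomp1f.
by rewrite -gcompA gcompVf gcompf1.
Qed.

Lemma conjtauM P Q R x y :
  conjtau P R (x * y) = conjtau P Q x · conjtau Q R y.
Proof.
rewrite /conjtau iotaM !gcompA -(gcompA _ (tau F Q) (ginv (tau F Q))).
by rewrite gcompfV gcompf1.
Qed.

Definition calV (P Q : Ob) : set (G P Q) := [set conjtau P Q g | g in V].
Arguments calV : clear implicits.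

Definition calH (P Q : Ob) : set (G P Q) :=
  [set conjtau P Q (gam P * x * (gam Q)^-1) | x in H].
Arguments calH : clear implicits.

Definition mkV (P Q : Ob) (g : V) : calV P Q :=
  SigSub (mem_set (ex_intro2 _ _ (val g) (set_mem (valP g)) erefl)).

Definition mkH (P Q : Ob) (x : H) : calH P Q :=
  SigSub (mem_set (ex_intro2 _ _ (val x) (set_mem (valP x)) erefl)).

Lemma calV_val P Q (f : calV P Q) : conjtauV (val f) \in V.
Proof. by have /set_mem[g Vg <-] := valP f; rewrite conjtauK; exact: mem_set. Qed.

Lemma calH_val P Q (f : calH P Q) :
  (gam P)^-1 * conjtauV (val f) * gam Q \in H.
Proof.
have /set_mem[x Hx <-] := valP f.
by rewrite conjtauK !mulgA mulVg mul1g mulgVK; exact: mem_set.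
Qed.

Definition coordV P Q (f : calV P Q) : V := SigSub (calV_val f).
Definition coordH P Q (f : calH P Q) : H := SigSub (calH_val f).

Lemma mkVK P Q : cancel (@mkV P Q) (@coordV P Q).
Proof. by move=> g; apply: val_inj; rewrite /= conjtauK. Qed.

Lemma coordVK P Q : cancel (@coordV P Q) (@mkV P Q).
Proof. by move=> f; apply: val_inj; rewrite /= conjtauVK. Qed.

Lemma mkHK P Q : cancel (@mkH P Q) (@coordH P Q).
Proof.
by move=> x; apply: val_inj; rewrite /= conjtauK !mulgA mulVg mul1g mulgVK.
Qed.

Lemma coordHK P Q : cancel (@coordH P Q) (@mkH P Q).
Proof.
by move=> f; apply: val_inj; rewrite /= !mulgA mulgV mul1g mulgK conjtauVK.
Qed.

Lemma dphi_mem (x : H) : dphi X (val x) \in V.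
Proof.
apply: mem_set; case: (dphi_bij X) => + _ _; apply; exact: set_mem (valP x).
Qed.

Lemma dphiV_mem (g : V) : dphiV (val g) \in H.
Proof. by apply/mem_set/dphiV_H/set_mem/(valP g). Qed.

Definition phi P Q (f : calH P Q) : calV P Q :=
  mkV P Q (SigSub (dphi_mem (coordH f))).

Definition phiV P Q (f : calV P Q) : calH P Q :=
  mkH P Q (SigSub (dphiV_mem (coordV f))).

Lemma phiK P Q : cancel (@phi P Q) (@phiV P Q).
Proof.
move=> f; rewrite /phiV /phi mkVK -[RHS]coordHK; congr mkH.
by apply: val_inj => /=; apply: dphiK; apply: set_mem (calH_val f).
Qed.

Lemma phiVK P Q : cancel (@phiV P Q) (@phi P Q).
Proof.
move=> f; rewrite /phiV /phi mkHK -[RHS]coordVK; congr mkV.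
by apply: val_inj => /=; apply: dphiVK; apply: set_mem (calV_val f).
Qed.

Definition VH_pair (P R : Ob) : Type := {S : Ob & (calV P S * calH S R)%type}.

Lemma VH_factor_exists P R (f : G P R) :
  exists t : VH_pair P R, f = val (projT2 t).1 · val (projT2 t).2.
Proof.
have [[[g S] x] [[/= Vg Hx E] _]] := dfactor X (conjtauV f * gam R).
exists (existT _ S
  (mkV P S (SigSub (mem_set Vg)), mkH S R (SigSub (mem_set Hx)))).
rewrite /= -conjtauM !mulgA -E mulgK; exact/esym/conjtauVK.
Qed.

Lemma VH_factor_unique P R (t u : VH_pair P R) :
  val (projT2 t).1 · val (projT2 t).2 = val (projT2 u).1 · val (projT2 u).2 ->
  t = u.
Proof.
case: t u => [S [v h]] [S' [v' h']] /=.
rewrite -(coordVK v) -(coordVK v') -(coordHK h) -(coordHK h').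
move: (coordV v) (coordV v') (coordH h) (coordH h').
move=> {v v' h h'} [g Vg] [g' Vg'] [x Hx] [x' Hx'] /=.
rewrite -!conjtauM => /(can_inj (@conjtauK P R)).
rewrite !mulgA => /(mulIg (gam R)^-1) E.
have [t [_ tu]] := dfactor X (g * gam S * x).
have e1 : t = (g, S, x) by apply: tu; split => //; exact: set_mem.
have e2 : t = (g', S', x') by apply: tu; split => //; exact: set_mem.
move: e2; rewrite e1 => -[eg eS ex]; subst g' S' x'.
by rewrite (bool_irrelevance Vg Vg') (bool_irrelevance Hx Hx').
Qed.

Definition VH_factor P R (f : G P R) : VH_pair P R :=
  projT1 (cid (VH_factor_exists f)).

Lemma VH_factorE P R (f : G P R) :
  f = val (projT2 (VH_factor f)).1 · val (projT2 (VH_factor f)).2.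
Proof. exact: projT2 (cid (VH_factor_exists f)). Qed.

(* [HVl x g] is x ⇀ g and [HVr x g] is x ↼ g: the 𝒱- and ℋ-factors of xg,
   which meet at the object [HVmid x g]. *)
Definition HVmid P Q R (x : calH P Q) (g : calV Q R) : Ob :=
  projT1 (VH_factor (val x · val g)).

Definition HVl P Q R (x : calH P Q) (g : calV Q R) : calV P (HVmid x g) :=
  (projT2 (VH_factor (val x · val g))).1.

Definition HVr P Q R (x : calH P Q) (g : calV Q R) : calH (HVmid x g) R :=
  (projT2 (VH_factor (val x · val g))).2.

Definition Vmid P Q R (g : calV P Q) (h : calV Q R) : Ob := HVmid (phiV g) h.

Definition Vl P Q R (g : calV P Q) (h : calV Q R) : calV P (Vmid g h) :=
  HVl (phiV g) h.

Definition Vr P Q R (g : calV P Q) (h : calV Q R) : calV (Vmid g h) R :=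
  phi (HVr (phiV g) h).

Local Notation "g ⇀ h" := (Vl g h).
Local Notation "g ↼ h" := (Vr g h).

Definition VV_pair (P R : Ob) : Type := {S : Ob & (calV P S * calV S R)%type}.

Definition braiding P Q R (g : calV P Q) (h : calV Q R) : VV_pair P R :=
  existT (fun S => (calV P S * calV S R)%type) (Vmid g h) (g ⇀ h, g ↼ h).

End AssociatedGroupoid.

Arguments conjtau {D Ob O G} F P Q d.
Arguments calV {D Ob O} X {G} F P Q _.
Arguments calH {D Ob O} X {G} F P Q _.
Arguments mkV {D Ob O} X {G} F P Q g.
Arguments mkH {D Ob O} X {G} F P Q x.
Arguments VH_pair {D Ob O} X {G} F P R.
Arguments VH_factor {D Ob O} X {G} F {P R} f.
Arguments VV_pair {D Ob O} X {G} F P R.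
Arguments braiding {D Ob O} X {G} F {P Q R} g h.

Section Extension.
Variables (A : braidedGroupType) (P : groupType).

Record central_cocycle (psi : A -> A -> P) : Prop := CentralCocycle {
  psi_center : forall a b, center (psi a b);
  psi_mulr : forall a b c, psi a (b * c) = psi a b * psi (a ◁ b) c;
  psi_mull : forall a b c, psi (a * b) c = psi a (b ▷ c) * psi b c
}.

Lemma lactx1 (x : A) : x ▷ 1 = 1.
Proof.
have := lact_mul x 1 1; rewrite mulg1 ract1 => e.
by apply: (mulgI (x ▷ 1)); rewrite -e mulg1.
Qed.

Lemma ract1x (x : A) : 1 ◁ x = 1.
Proof.
have := ract_mul 1 1 x; rewrite mulg1 lact1 => e.
by apply: (mulgI (1 ◁ x)); rewrite -e mulg1.
Qed.

Variables (psi : A -> A -> P) (psiP : central_cocycle psi).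

Lemma psix1 a : psi a 1 = 1.
Proof.
have := psi_mulr psiP a 1 1; rewrite mulg1 ract1 => e.
by apply: (mulgI (psi a 1)); rewrite -e mulg1.
Qed.

Lemma psi1x a : psi 1 a = 1.
Proof.
have := psi_mull psiP 1 1 a; rewrite mulg1 lact1 => e.
by apply: (mulgI (psi 1 a)); rewrite -e mulg1.
Qed.

(* The phantom argument provides the cocycle identities to the group instance. *)
Definition ext of central_cocycle psi : Type := (A * P * A)%type.

Local Notation D := (ext psiP).

HB.instance Definition _ := Choice.copy D (A * P * A)%type.

Definition ext_mk (a : A) (p : P) (c : A) : D := (a, p, c).

Definition ext_mul (s t : D) : D :=
  let: (a, p, c) := s in let: (x, q, z) := t in
  ext_mk (a * (c ▷ x)) (p * psi c x * q) ((c ◁ x) * z).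

Definition ext_one : D := ext_mk 1 1 1.

Definition ext_inv (s : D) : D :=
  let: (a, p, c) := s in
  ext_mk (c^-1 ▷ a^-1) (p^-1 * psi c^-1 a^-1) (c^-1 ◁ a^-1).

Lemma ext_mulA : associative ext_mul.
Proof.
move=> [[a p] c] [[x q] z] [[u r] w]; congr (_, _, _).
- by rewrite lact_mul lactM !mulgA.
- rewrite (psi_mulr psiP) (psi_mull psiP) !mulgA; congr (_ * _).
  have C1 := psi_center psiP (c ◁ x) (z ▷ u).
  by rewrite -!mulgA; congr (_ * (_ * _)); rewrite !mulgA (C1 q).
- by rewrite ractM ract_mul !mulgA.
Qed.

Lemma ext_mul1g : left_id ext_one ext_mul.
Proof.
by move=> [[a p] c]; congr (_, _, _);
  rewrite ?lact1 ?ract1x ?psi1x ?mul1g.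
Qed.

Lemma ext_mulg1 : right_id ext_one ext_mul.
Proof.
by move=> [[a p] c]; congr (_, _, _);
  rewrite ?lactx1 ?ract1 ?psix1 ?mulg1.
Qed.

Lemma ext_mulVg : left_inverse ext_one ext_inv ext_mul.
Proof.
move=> [[a p] c]; congr (_, _, _).
- by rewrite -lact_mul mulVg lactx1.
- have := psi_mulr psiP c^-1 a^-1 a; rewrite mulVg psix1 => e.
  by rewrite -[p^-1 * _ * _]mulgA -e mulg1 mulVg.
- by rewrite -ractM mulVg ract1 mulVg.
Qed.

Lemma ext_mulgV : right_inverse ext_one ext_inv ext_mul.
Proof.
move=> s; have E := ext_mulVg (ext_inv s).
by rewrite -[LHS]ext_mul1g -{1}E -ext_mulA (ext_mulA (ext_inv s)) ext_mulVg
  ext_mul1g E.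
Qed.

HB.instance Definition _ :=
  isGroup.Build D ext_mulA ext_mul1g ext_mulg1 ext_mulVg ext_mulgV.

Definition extV : set D := ([set: A] `*` [set 1]) `*` [set 1].
Definition extH : set D := ([set 1] `*` [set 1]) `*` [set: A].
Definition ext_gam (p : P) : D := ext_mk 1 p 1.
Definition ext_phi (s : D) : D := ext_mk s.2 1 1.

Lemma extVM a b : ext_mk a 1 1 * ext_mk b 1 1 = ext_mk (a * b) 1 1.
Proof. by congr (_, _, _); rewrite ?lact1 ?psi1x ?ract1x ?mulg1. Qed.

Lemma extHM a b : ext_mk 1 1 a * ext_mk 1 1 b = ext_mk 1 1 (a * b).
Proof. by congr (_, _, _); rewrite ?lactx1 ?psix1 ?ract1 ?mulg1. Qed.

Lemma extVE (s : D) : extV s -> s = ext_mk s.1.1 1 1.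
Proof. by case: s => [[a p] c] [[_ /= ->] ->]. Qed.

Lemma extHE (s : D) : extH s -> s = ext_mk 1 1 s.2.
Proof. by case: s => [[a p] c] [[/= -> ->] _]. Qed.

Lemma ext_mkV a : extV (ext_mk a 1 1). Proof. by []. Qed.
Lemma ext_mkH a : extH (ext_mk 1 1 a). Proof. by []. Qed.

Lemma extV_subgroup : subgroup_set extV.
Proof.
split=> [|s t /extVE-> /extVE->|s /extVE->]; first exact: ext_mkV.
  by rewrite extVM; exact: ext_mkV.
suff -> : (ext_mk s.1.1 1 1)^-1 = ext_mk (s.1.1)^-1 1 1 by exact: ext_mkV.
by apply: mulg1_eq; rewrite extVM mulgV.
Qed.

Lemma extH_subgroup : subgroup_set extH.
Proof.
split=> [|s t /extHE-> /extHE->|s /extHE->]; first exact: ext_mkH.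
  by rewrite extHM; exact: ext_mkH.
suff -> : (ext_mk 1 1 s.2)^-1 = ext_mk 1 1 (s.2)^-1 by exact: ext_mkH.
by apply: mulg1_eq; rewrite extHM mulgV.
Qed.

Lemma ext_factorE a p c :
  ext_mk a 1 1 * ext_gam p * ext_mk 1 1 c = ext_mk a p c.
Proof.
by congr (_, _, _); rewrite ?lact1 ?lactx1 ?ract1 ?psi1x ?psix1 ?mulg1 ?mul1g.
Qed.

Lemma ext_factor (d : D) : exists! t : D * P * D,
  [/\ extV t.1.1, extH t.2 & d = t.1.1 * ext_gam t.1.2 * t.2].
Proof.
case: d => [[a p] c]; exists (ext_mk a 1 1, p, ext_mk 1 1 c); split.
  by split; [exact: ext_mkV|exact: ext_mkH|rewrite ext_factorE].
move=> [[v q] h] [/= /extVE-> /extHE->].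
by rewrite ext_factorE => -[-> -> ->].
Qed.

Lemma extVH_conj (z : D) : extV `&` [set z * x * z^-1 | x in extH] = [set 1].
Proof.
apply/seteqP; split=> [s [/extVE Es [x /extHE Ex]]|s ->]; last first.
  by split; [exact: ext_mkV|exists 1; [exact: ext_mkH|rewrite mulg1 mulgV]].
move/(congr1 (fun t => t * z)); rewrite mulgVK {}Es {}Ex.
case: z => [[a p] c] /(congr1 fst)/(congr1 fst) /=.
rewrite lactx1 lact1 mulg1 -[LHS]mul1g => /mulIg <-; exact: erefl.
Qed.

Lemma ext_phi_bij : set_bij extH extV ext_phi.
Proof.
split=> [s _|s t /set_mem/extHE Es /set_mem/extHE Et|s /extVE Es].
- exact: ext_mkV.
- by rewrite Es Et => -[->].
- by exists (ext_mk 1 1 s.1.1); [exact: ext_mkH|rewrite Es].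
Qed.

Lemma ext_phiM s t :
  extH s -> extH t -> ext_phi (s * t) = ext_phi s * ext_phi t.
Proof. by move=> /extHE-> /extHE->; rewrite extHM extVM. Qed.

Definition ext_datum : datum D (1 : P) :=
  @Datum D P 1 extV extH ext_gam ext_phi extV_subgroup extH_subgroup
    (erefl _) ext_factor extVH_conj ext_phi_bij ext_phiM.

Definition inV (a : A) : dV ext_datum := SigSub (mem_set (ext_mkV a)).

End Extension.

(* Main.v *)
Require Import Defs.
From HB Require Import structures.
From mathcomp Require Import all_boot.
From mathcomp Require Import boolp classical_sets functions.

Local Open Scope group_scope.

(** Factorizations into a 𝒱-arrow followed by an ℋ-arrow are unique, so exhibiting one for φ⁻¹(α)β
    determines the braiding, its middle object included ([braiding_factor]). After removing the τ's
    this is an identity in D ([ext_crossing]): γ_P(1,1,a)γ_Q⁻¹(b,1,1) = (a▷b,1,1)γ_S(1,1,a◁b)γ_R⁻¹.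
    The middle coordinates give PQ⁻¹ψ(a,b) = SR⁻¹, and centrality of ψ(a,b) yields S. *)

Lemma VH_factor_mk {D : groupType} {Ob : Type} {O : Ob} (X : datum D O)
  {G : groupoid Ob} (F : vertex_frame D O G) (P R S : Ob) (f : G P R)
  (v : calV X F P S) (h : calH X F S R) :
  f = val v · val h -> VH_factor X F f = existT _ S (v, h).
Proof. by move=> fE; apply: VH_factor_unique; rewrite -VH_factorE. Qed.

Lemma braiding_factor {D : groupType} {Ob : Type} {O : Ob} (X : datum D O)
  {G : groupoid Ob} (F : vertex_frame D O G) (P Q R S : Ob)
  (g : calV X F P Q) (h : calV X F Q R)
  (v : calV X F P S) (x : calH X F S R) :
  val (phiV g) · val h = val v · val x ->
  braiding X F g h =
    existT (fun T => (calV X F P T * calV X F T R)%type) S (v, phi x).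
Proof.
(* The types of both factors depend on the middle object, so everything is unfolded to [VH_factor]
   and the whole dependent pair is replaced at once. *)
move=> fE; have E := VH_factor_mk X F _ _ _ _ _ _ fE; rewrite /braiding /Vl /Vr /Vmid /HVl /HVr /HVmid.
by rewrite E.
Qed.

Section Extension.
Context {A : braidedGroupType} {Pgrp : groupType} {psi : A -> A -> Pgrp}.
Context (psiP : central_cocycle psi).

Definition inH (a : A) : dH (ext_datum psiP) :=
  SigSub (mem_set (ext_mkH psiP a)).

Lemma ext_gamV p : (ext_gam psiP p)^-1 = ext_gam psiP p^-1.
Proof.
apply: mulg1_eq.
by congr (_, _, _); rewrite ?lact1 ?ract1 ?(psi1x psiP) ?mulg1 ?mulgV.
Qed.

(* The elements [ext_gam p] commute with V and H, so both sides equal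
   (a ▷ b, p q^-1 psi a b, a ◁ b). *)
Lemma ext_crossing p q r a b :
  ext_gam psiP p * ext_mk psiP 1 1 a * (ext_gam psiP q)^-1
    * ext_mk psiP b 1 1 =
  ext_mk psiP (a ▷ b) 1 1 *
    (ext_gam psiP (psi a b * p * q^-1 * r) * ext_mk psiP 1 1 (a ◁ b)
      * (ext_gam psiP r)^-1).
Proof.
have psiC : psi a b * (p * q^-1) = p * q^-1 * psi a b.
  exact: psi_center psiP a b _.
rewrite !ext_gamV; congr (_, _, _) => /=;
  rewrite !(lact1, lactx1, ract1, ract1x, psi1x psiP, psix1 psiP, mulg1, mul1g) //.
by rewrite mulgK -[RHS]mulgA psiC.
Qed.

Section Frame.
Context {G : groupoid Pgrp} (F : vertex_frame (ext psiP) 1 G).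

Lemma phi_mkH P Q a :
  phi (mkH (ext_datum psiP) F P Q (inH a)) =
  mkV (ext_datum psiP) F P Q (inV psiP a).
Proof. by rewrite /phi mkHK; congr mkV; apply: val_inj. Qed.

(** [phiV] rests on a partial inverse obtained by choice, which does not compute; its value comes
    from [phi_mkH] by cancellation. *)
Lemma phiV_mkV P Q a :
  phiV (mkV (ext_datum psiP) F P Q (inV psiP a)) =
  mkH (ext_datum psiP) F P Q (inH a).
Proof. by rewrite -phi_mkH phiK. Qed.

End Frame.
End Extension.

Theorem proposition3p5 (A : braidedGroupType) (Pgrp : groupType)
  (psi : A -> A -> Pgrp) (psiP : central_cocycle psi)
  (G : groupoid Pgrp) (Gconn : connected_groupoid G)
  (F : vertex_frame (ext psiP) 1 G)
  (P Q R : Pgrp) (a b : A)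
  (alpha : calV (ext_datum psiP) F P Q) (beta : calV (ext_datum psiP) F Q R)
  (alphaE : val alpha = conjtau F P Q (ext_mk psiP a 1 1))
  (betaE : val beta = conjtau F Q R (ext_mk psiP b 1 1)) :
  let S := psi a b * P * Q^-1 * R in
  braiding (ext_datum psiP) F alpha beta =
    existT (fun T => (calV (ext_datum psiP) F P T * calV (ext_datum psiP) F T R)%type)
      S (mkV (ext_datum psiP) F P S (inV psiP (a ▷ b)),
         mkV (ext_datum psiP) F S R (inV psiP (a ◁ b))).
Proof.
move=> S.
have -> : alpha = mkV (ext_datum psiP) F P Q (inV psiP a) by exact: val_inj.
have -> : beta = mkV (ext_datum psiP) F Q R (inV psiP b) by exact: val_inj.
(* The second component must appear as the [phi]-image of the ℋ-factor. *)
rewrite -(phi_mkH psiP F S R); apply: braiding_factor.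
(* [conjtauM] merges each side into [conjtau] of a single product in D. *)
by rewrite phiV_mkV /= -!conjtauM (ext_crossing psiP P Q R).
Qed.
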